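(* Let $\{M,(\cdot,\cdot)\}$ be a bicomplex Hilbert space and let $f:M\rightarrow\mathbb{T}$ be a continuous linear functional on $M$. Then there is a unique $\psi\in M$ such that $f(\phi)=(\psi,\phi)$ for all $\phi\in M$.
   Context: Bicomplex numbers: $\mathbb{T}=\{z_1+z_2\mathbf{i_2} : z_1,z_2\in\mathbb{C}(\mathbf{i_1})\}$ with $\mathbb{C}(\mathbf{i_1})=\{x+y\mathbf{i_1}: x,y\in\mathbb{R}\}$, $\mathbf{i_1}^2=\mathbf{i_2}^2=-1$, $\mathbf{j}=\mathbf{i_1}\mathbf{i_2}=\mathbf{i_2}\mathbf{i_1}$, $\mathbf{j}^2=1$; this is a commutative ring. Put $\mathbf{e_1}=(1+\mathbf{j})/2$, $\mathbf{e_2}=(1-\mathbf{j})/2$, so $\mathbf{e_1}+\mathbf{e_2}=1$, $\mathbf{e_1}\mathbf{e_2}=0$, $\mathbf{e_k}^2=\mathbf{e_k}$. Each $w\in\mathbb{T}$ is uniquely $w=z_{\widehat 1}\mathbf{e_1}+z_{\widehat 2}\mathbf{e_2}$ with $z_{\widehat k}\in\mathbb{C}(\mathbf{i_1})$; put $P_k(w)=z_{\widehat k}$, $w^{\dagger_3}=\bar z_{\widehat 1}\mathbf{e_1}+\bar z_{\widehat 2}\mathbf{e_2}$ (bar = complex conjugation in $\mathbb{C}(\mathbf{i_1})$), and $|w|=\frac{1}{\sqrt2}\sqrt{|z_{\widehat 1}|^2+|z_{\widehat 2}|^2}$ (the Euclidean norm on $\mathbb{R}^4$). Let $\mathbb{D}^+=\{x_{\widehat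 1}\mathbf{e_1}+x_{\widehat 2}\mathbf{e_2}: x_{\widehat 1},x_{\widehat 2}\in\mathbb{R},\ x_{\widehat 1},x_{\widehat 2}\ge 0\}$. A bicomplex scalar product on a $\mathbb{T}$-module $M$ is a map $(\cdot,\cdot):M\times M\to\mathbb{T}$ such that for all $\psi,\phi,\chi\in M$, $\alpha\in\mathbb{T}$: (1) $(\psi,\phi+\chi)=(\psi,\phi)+(\psi,\chi)$; (2) $(\psi,\alpha\phi)=\alpha(\psi,\phi)$; (3) $(\psi,\phi)=(\phi,\psi)^{\dagger_3}$; (4) $(\psi,\psi)=0\Leftrightarrow\psi=0$. Standing assumption: it is hyperbolic positive, i.e. $(\psi,\psi)\in\mathbb{D}^+$ for all $\psi\in M$. Then $\{M,(\cdot,\cdot)\}$ is called a bicomplex pre-Hilbert space (or $\mathbb{T}$-inner product space). Write $(\cdot,\cdot)_{\widehat k}=P_k((\cdot,\cdot))$. The induced $\mathbb{T}$-norm is $\|\phi\|=\frac{1}{\sqrt2}\sqrt{(\mathbf{e_1}\phi,\mathbf{e_1}\phi)_{\widehat 1}+(\mathbf{e_2}\phi,\mathbf{e_2}\phi)_{\widehat 2}}$. A bicomplex Hilbert space is a $\mathbb{T}$-inner product space that is complete with respect to $\|\cdot\|$. A linear functional $f:M\to\mathbb{T}$ is a $\mathbb{T}$-linear map: $f(s\psi+t\phi)=sf(\psi)+tf(\phi)$ for $s,t\in\mathbb{T}$. Continuity is with respect to $\|\cdot\|$ on $M$ and $|\cdot|$ on $\mathbb{T}$. *)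

(* Defs.v *)
From HB Require Import structures.
From mathcomp Require Import all_boot all_order all_algebra.
From mathcomp Require Import all_classical all_reals.
From mathcomp Require Import topology normedtype.
From mathcomp Require Import complex.
From mathcomp Require Import ring lra.

Set Implicit Arguments.
Unset Strict Implicit.
Unset Printing Implicit Defensive.

Import Order.TTheory GRing.Theory Num.Theory.
Import numFieldNormedType.Exports.
Import ComplexField.Normc.

Local Open Scope classical_set_scope.
Local Open Scope ring_scope.
Local Open Scope complex_scope.

(* The bicomplex number z1 + z2 i2, with z1 and z2 in C(i1) = R[i]. *)
Record bicomplex (R : Type) := Bicomplex { bc1 : R[i]; bc2 : R[i] }.

Section BicomplexChoice.
Variable R : Type.
Definition pair_of_bicomplex (w : bicomplex R) := (bc1 w, bc2 w).
Definition bicomplex_of_pair (p : R[i] * R[i]) := Bicomplex p.1 p.2.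
Lemma pair_of_bicomplexK : cancel pair_of_bicomplex bicomplex_of_pair.
Proof. by case. Qed.
End BicomplexChoice.

HB.instance Definition _ (R : choiceType) :=
  Choice.copy (bicomplex R) (can_type (@pair_of_bicomplexK R)).

Fact idempotent_mulB (C : comPzRingType) (i a b c d : C) : i ^+ 2 = -1 ->
  a * c - b * d - i * (a * d + b * c) = (a - i * b) * (c - i * d).
Proof. by move=> i2; ring: i2. Qed.
Fact idempotent_mulD (C : comPzRingType) (i a b c d : C) : i ^+ 2 = -1 ->
  a * c - b * d + i * (a * d + b * c) = (a + i * b) * (c + i * d).
Proof. by move=> i2; ring: i2. Qed.
Fact idempotent_inj (F : numFieldType) (i a b c d : F) : i ^+ 2 = -1 ->
  a - i * b = c - i * d -> a + i * b = c + i * d -> a = c /\ b = d.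
Proof.
move=> i2 h1 h2; have n2 : (2%:R : F) != 0 by rewrite pnatr_eq0.
have sum (x y : F) : 2%:R * x = (x - i * y) + (x + i * y) by ring.
have dif (x y : F) : 2%:R * y = - (i * ((x + i * y) - (x - i * y))) by ring: i2.
by split; apply: (mulfI n2); [rewrite (sum a b) (sum c d)|
  rewrite (dif a b) (dif c d)]; rewrite h1 h2.
Qed.

Section BicomplexRing.
Variable R : realType.
Implicit Types w v u : bicomplex R.

Definition bicomplex_add w v := Bicomplex (bc1 w + bc1 v) (bc2 w + bc2 v).
Definition bicomplex_opp w := Bicomplex (- bc1 w) (- bc2 w).
Definition bicomplex_mul w v :=
  Bicomplex (bc1 w * bc1 v - bc2 w * bc2 v) (bc1 w * bc2 v + bc2 w * bc1 v).

Fact bicomplex_addA : associative bicomplex_add.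
Proof. by move=> w v u; rewrite /bicomplex_add /= !addrA. Qed.
Fact bicomplex_addC : commutative bicomplex_add.
Proof. by move=> w v; congr Bicomplex; rewrite addrC. Qed.
Fact bicomplex_add0 : left_id (Bicomplex 0 0) bicomplex_add.
Proof. by case=> a b; rewrite /bicomplex_add /= !add0r. Qed.
Fact bicomplex_addN : left_inverse (Bicomplex 0 0) bicomplex_opp bicomplex_add.
Proof. by case=> a b; rewrite /bicomplex_add /= !addNr. Qed.

HB.instance Definition _ := GRing.isZmodule.Build (bicomplex R)
  bicomplex_addA bicomplex_addC bicomplex_add0 bicomplex_addN.

Fact bicomplex_mulA : associative bicomplex_mul.
Proof. by move=> w v u; congr Bicomplex => /=; ring. Qed.
Fact bicomplex_mulC : commutative bicomplex_mul.
Proof. by move=> w v; congr Bicomplex => /=; ring. Qed.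
Fact bicomplex_mul1 : left_id (Bicomplex 1 0) bicomplex_mul.
Proof. by case=> a b; congr Bicomplex => /=; ring. Qed.
Fact bicomplex_mulDl : left_distributive bicomplex_mul +%R.
Proof. by move=> w v u; congr Bicomplex => /=; ring. Qed.
Fact bicomplex_oner_neq0 : Bicomplex 1 0 != 0 :> bicomplex R.
Proof. by apply/eqP => -[/eqP]; rewrite oner_eq0. Qed.

HB.instance Definition _ := GRing.Zmodule_isComNzRing.Build (bicomplex R)
  bicomplex_mulA bicomplex_mulC bicomplex_mul1 bicomplex_mulDl
  bicomplex_oner_neq0.

Definition bicomplex_of_complex (z : R[i]) : bicomplex R := Bicomplex z 0.
Local Notation "z %:BC" := (bicomplex_of_complex z)
  (at level 1, format "z %:BC").

Definition bi1 : bicomplex R := ('i)%:BC.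
Definition bi2 : bicomplex R := Bicomplex 0 1.
Definition bj : bicomplex R := bi1 * bi2.
Definition be1 : bicomplex R := (2%:R^-1)%:BC * (1 + bj).
Definition be2 : bicomplex R := (2%:R^-1)%:BC * (1 - bj).

(* The components of w = P1 w e1 + P2 w e2, see [bicomplex_idempotentE] and
   [bicomplex_idempotent_uniq]. *)
Definition P1 w : R[i] := bc1 w - 'i * bc2 w.
Definition P2 w : R[i] := bc1 w + 'i * bc2 w.

Definition dagger3 w : bicomplex R :=
  ((P1 w)^*)%:BC * be1 + ((P2 w)^*)%:BC * be2.

Definition bicomplex_norm w : R :=
  (Num.sqrt 2%:R)^-1 * Num.sqrt (normc (P1 w) ^+ 2 + normc (P2 w) ^+ 2).

Definition Dplus : set (bicomplex R) :=
  [set w | exists x1 x2 : R,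
     [/\ 0 <= x1, 0 <= x2 & w = (x1%:C)%:BC * be1 + (x2%:C)%:BC * be2]].

Lemma bi1_sqr : bi1 ^+ 2 = -1.
Proof.
rewrite expr2; congr Bicomplex => /=;
  rewrite ?mulr0 ?mul0r ?subr0 ?addr0 ?oppr0//.
by rewrite -expr2 sqr_i.
Qed.
Lemma bi2_sqr : bi2 ^+ 2 = -1.
Proof. by rewrite expr2; congr Bicomplex => /=; ring. Qed.

Fact P1_is_additive : {morph P1 : w v / w - v}.
Proof. by move=> w v; rewrite /P1 /=; ring. Qed.
Fact P2_is_additive : {morph P2 : w v / w - v}.
Proof. by move=> w v; rewrite /P2 /=; ring. Qed.
Fact P1_is_multiplicative : multiplicative P1.
Proof.
split=> [[a b] [c d]|]; last by rewrite /P1 /= mulr0 subr0.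
exact: idempotent_mulB (sqr_i R).
Qed.
Fact P2_is_multiplicative : multiplicative P2.
Proof.
split=> [[a b] [c d]|]; last by rewrite /P2 /= mulr0 addr0.
exact: idempotent_mulD (sqr_i R).
Qed.
HB.instance Definition _ := GRing.isZmodMorphism.Build _ _ P1 P1_is_additive.
HB.instance Definition _ := GRing.isZmodMorphism.Build _ _ P2 P2_is_additive.
HB.instance Definition _ :=
  GRing.isMultiplicative.Build _ _ P1 P1_is_multiplicative.
HB.instance Definition _ :=
  GRing.isMultiplicative.Build _ _ P2 P2_is_multiplicative.

Lemma P1D w v : P1 (w + v) = P1 w + P1 v. Proof. exact: rmorphD. Qed.
Lemma P1B w v : P1 (w - v) = P1 w - P1 v. Proof. exact: rmorphB. Qed.
Lemma P1N w : P1 (- w) = - P1 w. Proof. exact: rmorphN. Qed.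
Lemma P1M w v : P1 (w * v) = P1 w * P1 v. Proof. exact: rmorphM. Qed.
Lemma P1Mn w n : P1 (w *+ n) = P1 w *+ n. Proof. exact: rmorphMn. Qed.
Lemma P1_0 : P1 0 = 0. Proof. exact: rmorph0. Qed.
Lemma P1_1 : P1 1 = 1. Proof. exact: rmorph1. Qed.

Lemma P2D w v : P2 (w + v) = P2 w + P2 v. Proof. exact: rmorphD. Qed.
Lemma P2B w v : P2 (w - v) = P2 w - P2 v. Proof. exact: rmorphB. Qed.
Lemma P2N w : P2 (- w) = - P2 w. Proof. exact: rmorphN. Qed.
Lemma P2M w v : P2 (w * v) = P2 w * P2 v. Proof. exact: rmorphM. Qed.
Lemma P2Mn w n : P2 (w *+ n) = P2 w *+ n. Proof. exact: rmorphMn. Qed.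
Lemma P2_0 : P2 0 = 0. Proof. exact: rmorph0. Qed.
Lemma P2_1 : P2 1 = 1. Proof. exact: rmorph1. Qed.

Lemma P1_complex z : P1 z%:BC = z. Proof. by rewrite /P1 /= mulr0 subr0. Qed.
Lemma P2_complex z : P2 z%:BC = z. Proof. by rewrite /P2 /= mulr0 addr0. Qed.

Lemma P1_bj : P1 bj = 1.
Proof.
rewrite /bj P1M /bi1 P1_complex /P1 /= mulr1 sub0r mulrN.
by rewrite -expr2 sqr_i opprK.
Qed.
Lemma P2_bj : P2 bj = -1.
Proof. by rewrite /bj P2M /bi1 P2_complex /P2 /= mulr1 add0r -expr2 sqr_i. Qed.

Lemma P1_be1 : P1 be1 = 1.
Proof. by rewrite /be1 P1M P1D P1_1 P1_bj P1_complex mulVf// pnatr_eq0. Qed.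
Lemma P2_be1 : P2 be1 = 0.
Proof. by rewrite /be1 P2M P2D P2_1 P2_bj subrr mulr0. Qed.
Lemma P1_be2 : P1 be2 = 0.
Proof. by rewrite /be2 P1M P1B P1_1 P1_bj subrr mulr0. Qed.
Lemma P2_be2 : P2 be2 = 1.
Proof.
by rewrite /be2 P2M P2B P2_1 P2_bj P2_complex opprK mulVf// pnatr_eq0.
Qed.

Lemma P12_inj w v : P1 w = P1 v -> P2 w = P2 v -> w = v.
Proof.
case: w v => [a b] [c d] h1 h2.
by have /= [-> ->] := idempotent_inj (sqr_i R) h1 h2.
Qed.

Lemma P1_idempotent (z1 z2 : R[i]) : P1 (z1%:BC * be1 + z2%:BC * be2) = z1.
Proof.
rewrite P1D (P1M z1%:BC) (P1M z2%:BC) P1_be1 P1_be2.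
by rewrite !P1_complex mulr1 mulr0 addr0.
Qed.
Lemma P2_idempotent (z1 z2 : R[i]) : P2 (z1%:BC * be1 + z2%:BC * be2) = z2.
Proof.
rewrite P2D (P2M z1%:BC) (P2M z2%:BC) P2_be1 P2_be2.
by rewrite !P2_complex mulr0 add0r mulr1.
Qed.

Lemma bicomplex_idempotentE w : w = (P1 w)%:BC * be1 + (P2 w)%:BC * be2.
Proof. by apply: P12_inj; rewrite ?P1_idempotent ?P2_idempotent. Qed.

Lemma bicomplex_idempotent_uniq w (z1 z2 : R[i]) :
  w = z1%:BC * be1 + z2%:BC * be2 -> z1 = P1 w /\ z2 = P2 w.
Proof. by move->; rewrite P1_idempotent P2_idempotent. Qed.

Lemma P1_dagger3 w : P1 (dagger3 w) = (P1 w)^*.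
Proof. exact: P1_idempotent. Qed.
Lemma P2_dagger3 w : P2 (dagger3 w) = (P2 w)^*.
Proof. exact: P2_idempotent. Qed.

Lemma normc_sqr (z : R[i]) :
  normc z ^+ 2 = complex.Re z ^+ 2 + complex.Im z ^+ 2.
Proof. by case: z => a b /=; rewrite sqr_sqrtr ?addr_ge0 ?sqr_ge0. Qed.

(* |w| is the Euclidean norm on R^4. *)
Lemma bicomplex_norm_euclid w : bicomplex_norm w =
  Num.sqrt (complex.Re (bc1 w) ^+ 2 + complex.Im (bc1 w) ^+ 2 +
            complex.Re (bc2 w) ^+ 2 + complex.Im (bc2 w) ^+ 2).
Proof.
rewrite /bicomplex_norm -sqrtrV// -sqrtrM ?invr_ge0//; congr Num.sqrt.
case: w => [[a b] [c d]]; rewrite !normc_sqr.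
rewrite /P1 /P2 /=.
by field.
Qed.

Lemma sqrt_sqrD4 (a b c d a' b' c' d' : R) :
  Num.sqrt ((a + a') ^+ 2 + (b + b') ^+ 2 + (c + c') ^+ 2 + (d + d') ^+ 2) <=
  Num.sqrt (a ^+ 2 + b ^+ 2 + c ^+ 2 + d ^+ 2) +
  Num.sqrt (a' ^+ 2 + b' ^+ 2 + c' ^+ 2 + d' ^+ 2).
Proof.
set p := a ^+ 2 + _ + _ + _; set q := a' ^+ 2 + _ + _ + _.
have p0 : 0 <= p by rewrite !addr_ge0 ?sqr_ge0.
have q0 : 0 <= q by rewrite !addr_ge0 ?sqr_ge0.
rewrite -[leRHS]ger0_norm ?addr_ge0 ?sqrtr_ge0// -sqrtr_sqr.
rewrite ler_sqrt ?sqr_ge0// [leRHS]sqrrD !sqr_sqrtr// -sqrtrM//.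
set x := a * a' + b * b' + c * c' + d * d'.
have xpq : x <= Num.sqrt (p * q).
  apply: le_trans (ler_norm _) _; rewrite -sqrtr_sqr ler_sqrt ?mulr_ge0//.
  rewrite -subr_ge0 (_ : _ - _ =
    (a * b' - b * a') ^+ 2 + (a * c' - c * a') ^+ 2 + (a * d' - d * a') ^+ 2 +
    (b * c' - c * b') ^+ 2 + (b * d' - d * b') ^+ 2 + (c * d' - d * c') ^+ 2).
    by rewrite !addr_ge0 ?sqr_ge0.
  by rewrite /p /q /x; ring.
rewrite [leLHS](_ : _ = p + x *+ 2 + q); last by rewrite /p /q /x; ring.
by rewrite lerD2r lerD2l lerMn2r.
Qed.

Fact bicomplex_ler_normD w v :
  bicomplex_norm (w + v) <= bicomplex_norm w + bicomplex_norm v.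
Proof.
rewrite !bicomplex_norm_euclid.
case: w v => [[a b] [c d]] [[a' b'] [c' d']] /=.
exact: sqrt_sqrD4.
Qed.

Fact bicomplex_norm_eq0 w : bicomplex_norm w = 0 -> w = 0.
Proof.
rewrite bicomplex_norm_euclid; case: w => [[a b] [c d]] /= /eqP.
rewrite sqrtr_eq0 => h.
have := sqr_ge0 a; have := sqr_ge0 b; have := sqr_ge0 c; have := sqr_ge0 d.
move=> hd hc hb ha.
have z (x : R) : 0 <= x ^+ 2 -> x ^+ 2 <= 0 -> x = 0.
  by move=> x0 x1; apply/eqP; rewrite -sqrf_eq0 eq_le x0 x1.
have -> : a = 0 by apply: z => //; lra.
have -> : b = 0 by apply: z => //; lra.
have -> : c = 0 by apply: z => //; lra.
by have -> : d = 0 by apply: z => //; lra.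
Qed.

Fact bicomplex_normMn w n : bicomplex_norm (w *+ n) = bicomplex_norm w *+ n.
Proof.
rewrite /bicomplex_norm P1Mn P2Mn -mulrnAr; congr (_ * _).
rewrite !normcMn -[RHS]ger0_norm ?mulrn_wge0 ?sqrtr_ge0// -sqrtr_sqr.
congr Num.sqrt; rewrite [RHS]exprMn_n sqr_sqrtr ?addr_ge0 ?sqr_ge0//.
by rewrite mulrnDl !exprMn_n.
Qed.

Fact bicomplex_normN w : bicomplex_norm (- w) = bicomplex_norm w.
Proof. by rewrite /bicomplex_norm P1N P2N !normcN. Qed.

HB.instance Definition _ := Num.Zmodule_isNormed.Build R (bicomplex R)
  bicomplex_ler_normD bicomplex_norm_eq0 bicomplex_normMn bicomplex_normN.
HB.instance Definition _ :=
  PseudoMetric.copy (bicomplex R) (pseudoMetric_normed (bicomplex R)).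
HB.instance Definition _ := isPointed.Build (bicomplex R) 0.
HB.instance Definition _ :=
  NormedZmod_PseudoMetric_eq.Build R (bicomplex R) erefl.

Lemma bicomplex_normE w : `|w| = bicomplex_norm w.
Proof. by []. Qed.

End BicomplexRing.

Notation "z %:BC" := (bicomplex_of_complex z)
  (at level 1, format "z %:BC") : ring_scope.

Arguments bi1 {R}.
Arguments bi2 {R}.
Arguments bj {R}.
Arguments be1 {R}.
Arguments be2 {R}.
Arguments Dplus {R}.

Section ScalarProduct.
Variables (R : realType) (M : lmodType (bicomplex R)).
Variable sp : M -> M -> bicomplex R.

Record is_bicomplex_scalar_product : Prop := IsBicomplexScalarProduct {
  spDr : forall psi phi chi, sp psi (phi + chi) = sp psi phi + sp psi chi;
  spZr : forall psi alpha phi, sp psi (alpha *: phi) = alpha * sp psi phi;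
  sp_dagger3 : forall psi phi, sp psi phi = dagger3 (sp phi psi);
  sp_eq0 : forall psi, sp psi psi = 0 <-> psi = 0;
  sp_hyperbolic_positive : forall psi, Dplus (sp psi psi)
}.

(* Both P_k terms have zero imaginary part, by hyperbolic positivity. *)
Definition induced_norm (phi : M) : R :=
  (Num.sqrt 2%:R)^-1 *
  Num.sqrt (complex.Re (P1 (sp (be1 *: phi) (be1 *: phi))) +
            complex.Re (P2 (sp (be2 *: phi) (be2 *: phi)))).

End ScalarProduct.

HB.mixin Record isBicomplexPreHilbert (R : realType) M
    & GRing.Lmodule (bicomplex R) M := {
  sprod : M -> M -> bicomplex R;
  sprodP : is_bicomplex_scalar_product sprod
}.

#[short(type="bicomplexPreHilbertType")]
HB.structure Definition BicomplexPreHilbert (R : realType) :=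
  {M of GRing.Lmodule (bicomplex R) M & isBicomplexPreHilbert R M}.

(* M with the norm and the topology induced by its scalar product.  This is an
   alias because the library allows a type to carry both a topology and a
   module structure only when the scalars form a numDomainType. *)
Definition tnormed (R : realType) (M : bicomplexPreHilbertType R) : Type := M.

Section InducedNorm.
Variables (R : realType) (M : bicomplexPreHilbertType R).

Local Notation sp := (@sprod R M).
Local Notation sprodP := (@sprodP R M).

Let form (x y : M) : R := complex.Re (P1 (sp x y)) + complex.Re (P2 (sp x y)).

Let ReD (z z' : R[i]) : complex.Re (z + z') = complex.Re z + complex.Re z'.
Proof. by case: z z' => [? ?] []. Qed.

Let formDr x y z : form x (y + z) = form x y + form x z.
Proof. by rewrite /form (spDr sprodP) P1D P2D !ReD addrACA. Qed.

Let formC x y : form x y = form y x.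
Proof.
rewrite /form [in LHS](sp_dagger3 sprodP) P1_dagger3 P2_dagger3.
by case: (P1 _) => [? ?]; case: (P2 _).
Qed.

Let formZr (r : R) x y : form x ((r%:C)%:BC *: y) = r * form x y.
Proof.
rewrite /form (spZr sprodP) P1M P2M P1_complex P2_complex.
by case: (P1 _) => [? ?]; case: (P2 _) => [? ?] /=; ring.
Qed.

Let formDl x y z : form (y + z) x = form y x + form z x.
Proof. by rewrite formC formDr (formC x y) (formC x z). Qed.

Let formZl (r : R) x y : form ((r%:C)%:BC *: y) x = r * form y x.
Proof. by rewrite formC formZr (formC x). Qed.

Let form_ge0 x : 0 <= form x x.
Proof.
have [x1 [x2 [h1 h2 e]]] := sp_hyperbolic_positive sprodP x.
by rewrite /form e P1_idempotent P2_idempotent addr_ge0.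
Qed.

Let form_eq0 x : form x x = 0 -> x = 0.
Proof.
move=> f0; apply/(sp_eq0 sprodP).
have [x1 [x2 [h1 h2 e]]] := sp_hyperbolic_positive sprodP x.
move: f0; rewrite /form e P1_idempotent P2_idempotent /= => s0.
have z1 : x1 = 0 by lra.
have z2 : x2 = 0 by lra.
by rewrite z1 z2; apply: P12_inj;
  rewrite ?P1_idempotent ?P2_idempotent ?P1_0 ?P2_0.
Qed.

Let form_CS x y : form x y ^+ 2 <= form x x * form y y.
Proof.
set a := form x x; set b := form x y; set c := form y y.
have [c0|c0] := eqVneq c 0.
  have y0 := form_eq0 c0.
  have -> : b = 0.
    have := formDr x y y; rewrite -/b y0 addr0 -y0 -/b => /eqP.
    by rewrite -subr_eq0 opprD addrA subrr sub0r oppr_eq0 => /eqP.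
  by rewrite c0 mulr0 expr0n.
have cp : 0 < c by rewrite lt_neqAle eq_sym c0 form_ge0.
have := form_ge0 ((c%:C)%:BC *: x + ((- b)%:C)%:BC *: y).
rewrite formDr !formDl !formZr !formZl (formC y x) -/a -/b -/c.
rewrite (_ : _ + _ = c * (a * c - b ^+ 2)); last by ring.
by rewrite pmulr_rge0// subr_ge0.
Qed.

Let norm : tnormed M -> R := induced_norm sp.

Let normE x : norm x = (Num.sqrt 2%:R)^-1 * Num.sqrt (form x x).
Proof.
rewrite /norm /induced_norm; congr (_ * Num.sqrt (_ + _)).
  rewrite (spZr sprodP) (sp_dagger3 sprodP) (spZr sprodP) P1M P1_be1 mul1r.
  rewrite P1_dagger3 P1M P1_be1 mul1r -P1_dagger3.
  by rewrite -(sp_dagger3 sprodP).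
rewrite (spZr sprodP) (sp_dagger3 sprodP) (spZr sprodP) P2M P2_be2 mul1r.
rewrite P2_dagger3 P2M P2_be2 mul1r -P2_dagger3.
by rewrite -(sp_dagger3 sprodP).
Qed.

Let sqrt2V_ge0 : 0 <= (Num.sqrt 2%:R : R)^-1.
Proof. by rewrite invr_ge0 sqrtr_ge0. Qed.

Let ler_normD (x y : M) : norm (x + y) <= norm x + norm y.
Proof.
rewrite !normE -mulrDr ler_wpM2l//.
rewrite -[leRHS]ger0_norm ?addr_ge0 ?sqrtr_ge0// -sqrtr_sqr.
rewrite ler_sqrt ?sqr_ge0// sqrrD !sqr_sqrtr// -sqrtrM//.
rewrite formDr !formDl (formC y x).
have h : form x y <= Num.sqrt (form x x * form y y).
  apply: le_trans (ler_norm _) _.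
  by rewrite -sqrtr_sqr ler_sqrt ?mulr_ge0// form_CS.
rewrite mulr2n; lra.
Qed.

Let norm_eq0 (x : M) : norm x = 0 -> x = 0.
Proof.
rewrite normE => /eqP; rewrite mulf_eq0 invr_eq0 !sqrtr_eq0.
rewrite leNgt ltr0n /= => f0; apply: form_eq0.
by apply/eqP; rewrite eq_le f0 form_ge0.
Qed.

Let normMn (x : M) n : norm (x *+ n) = norm x *+ n.
Proof.
have -> : x *+ n = ((n%:R%:C)%:BC : bicomplex R) *: x.
  rewrite -scaler_nat; congr (_ *: _).
  by apply: P12_inj; rewrite ?P1_complex ?P2_complex ?P1Mn ?P2Mn ?P1_1 ?P2_1;
    rewrite [RHS]rmorph_nat.
rewrite !normE formZr formZl mulrA -expr2 sqrtrM ?sqr_ge0// sqrtr_sqr.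
by rewrite normr_nat mulrCA mulr_natl.
Qed.

Let normN (x : M) : norm (- x) = norm x.
Proof.
have -> : - x = (((- 1)%:C)%:BC : bicomplex R) *: x.
  rewrite -scaleN1r; congr (_ *: _).
  by apply: P12_inj; rewrite ?P1_complex ?P2_complex ?P1N ?P2N ?P1_1 ?P2_1;
    rewrite [RHS]rmorphN rmorph1.
by rewrite !normE formZr formZl; congr (_ * Num.sqrt _); ring.
Qed.

HB.instance Definition _ := GRing.Zmodule.copy (tnormed M) M.
HB.instance Definition _ := Num.Zmodule_isNormed.Build R (tnormed M)
  ler_normD norm_eq0 normMn normN.
HB.instance Definition _ :=
  PseudoMetric.copy (tnormed M) (pseudoMetric_normed (tnormed M)).
HB.instance Definition _ := isPointed.Build (tnormed M) (0 : M).
HB.instance Definition _ :=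
  NormedZmod_PseudoMetric_eq.Build R (tnormed M) erefl.

Lemma tnormedE (phi : tnormed M) : `|phi| = induced_norm sp phi.
Proof. by []. Qed.

Lemma tnormed_continuousP (f : tnormed M -> bicomplex R) :
  continuous f <->
  forall (x : tnormed M) (e : R), 0 < e -> exists2 d : R, 0 < d &
    forall y : tnormed M,
      induced_norm sp (x - y) < d -> bicomplex_norm (f x - f y) < e.
Proof.
split=> [cf x e e0 | H x].
  have /cvgrPdist_lt /(_ e e0) /nbhs_normP [d d0 h] := cf x.
  by exists d => // y hy; exact: (h y).
apply: (proj2 (@cvgrPdist_lt _ _ _ (nbhs x) _ f (f x))) => e e0.
have [d d0 h] := H x e e0.
by apply: (proj2 (nbhs_normP x _)); exists d => // y; exact: h.
Qed.

End InducedNorm.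

HB.mixin Record BicomplexPreHilbert_isComplete (R : realType) M
    & BicomplexPreHilbert R M := {
  tnormed_cauchy_cvg : forall F : set_system (tnormed M),
    ProperFilter F -> cauchy F -> cvg F
}.

#[short(type="bicomplexHilbertType")]
HB.structure Definition BicomplexHilbert (R : realType) :=
  {M of BicomplexPreHilbert R M & BicomplexPreHilbert_isComplete R M}.

(* Main.v *)
Require Import Defs.
From HB Require Import structures.
From mathcomp Require Import all_boot all_order all_algebra.
From mathcomp Require Import all_classical all_reals.
From mathcomp Require Import topology normedtype.
From mathcomp Require Import complex.
From mathcomp Require Import ring lra.

Set Implicit Arguments.
Unset Strict Implicit.
Unset Printing Implicit Defensive.

Import Order.TTheory GRing.Theory Num.Theory.
Import numFieldNormedType.Exports.

Local Open Scope classical_set_scope.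
Local Open Scope ring_scope.

(* Re P1 + Re P2 of the scalar product is a real inner product inducing the
   same topology, so the real functional h = Re P1 f + Re P2 f is represented
   by some psi: the sublevel sets of x |-> g x x - 2 h x near its infimum form
   a Cauchy filter by the parallelogram law, and psi is its limit.  Then
   w = f phi - (psi, phi) vanishes, because the real identity at w^dagger3 phi
   reads |w|^2 = 0. *)

(** * Riesz representation for real symmetric positive forms *)

(** Discriminant bound: for [c > 0] the minimum [- (b ^+ 2 / c)] is attained at [t = - b / c]; for
    [c = 0] a nonzero slope would let the values reach [- (e + 1)]. *)
Lemma quadratic_lower_bound (R : realFieldType) (e b c : R) : 0 <= c ->
  (forall t, - e <= 2 * t * b + t ^+ 2 * c) -> b ^+ 2 <= e * c.
Proof.
rewrite le_eqVlt => /predU1P[<- H|c0 H].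
  have [->|b0] := eqVneq b 0; first by rewrite expr0n mulr0.
  have := H (- (e + 1) / (2 * b)).
  rewrite (_ : 2 * _ * b + _ = - (e + 1)); first by lra.
  by field; rewrite b0.
have := H (- b / c).
rewrite (_ : 2 * _ * b + _ = - (b ^+ 2 / c)).
  by rewrite lerN2 ler_pdivrMr.
by field; rewrite gt_eqF.
Qed.

Section RealRiesz.
Variables (R : realType) (V : lmodType R) (g : V -> V -> R).
Hypothesis gC : forall x y, g x y = g y x.
Hypothesis g_scalar : forall x, scalar (g x).
Hypothesis g_ge0 : forall x, 0 <= g x x.

Lemma form_expand x t y :
  g (x + t *: y) (x + t *: y) = g x x + 2 * t * g x y + t ^+ 2 * g y y.
Proof.
rewrite addrC (g_scalar (t *: y + x)) !(gC (t *: y + x)) !g_scalar (gC y x).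
ring.
Qed.

Lemma form_CauchySchwarz x y : g x y ^+ 2 <= g x x * g y y.
Proof.
apply: quadratic_lower_bound => // t.
by have := g_ge0 (x + t *: y); rewrite form_expand; lra.
Qed.

(** Completeness for the seminorm [sqrt (g x x)], stated with filters so that [V] carries no
    topology. *)
Hypothesis g_complete : forall F : set_system V, ProperFilter F ->
  (forall e, 0 < e ->
     exists2 A, F A & forall x y, A x -> A y -> g (x - y) (x - y) < e) ->
  exists p, forall e, 0 < e -> F [set x | g (p - x) (p - x) < e].

Lemma real_riesz (h : V -> R) (C : R) : scalar h -> 0 <= C ->
  (forall x, h x ^+ 2 <= C * g x x) -> exists p, forall x, h x = g p x.
Proof.
move=> hS C0 hC.
pose J x := g x x - 2 * h x.
(* [g x y - h y] is half the derivative of [J] at [x] along [y], so [h = g p] says that [p] is a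
   critical point. *)
have J_expand x t y :
    J (x + t *: y) = J x + 2 * t * (g x y - h y) + t ^+ 2 * g y y.
  by rewrite /J form_expand addrC (addrC x) hS; ring.
(* By AM-GM, [2 * h x <= 2 * sqrt (C * g x x) <= g x x + C]. *)
have J_ge x : - C <= J x.
  rewrite leNgt /J; apply/negP => JC; have := hC x; have := g_ge0 x.
  have : 0 < 2 * h x - (g x x + C) by lra.
  move=> /pmulr_lge0; have := sqr_ge0 (g x x - C); nra.
have Jinf : has_inf (range J).
  by split; [exists (J 0), 0|exists (- C) => _ [x _ <-]].
set m := inf (range J).
have mJ x : m <= J x by apply: ge_inf; [exact: Jinf.2|exists x].
pose F := filter_from [set e : R | 0 < e] (fun e => [set x | J x < m + e]).
have FF : ProperFilter F.
  apply: filter_from_proper.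
    apply: filter_from_filter; first by exists 1 => /=.
    move=> e1 e2 /= e10 e20; exists (Num.min e1 e2) => [|x /= Jx].
      by rewrite /= lt_min e10.
    by split; apply: lt_le_trans Jx _; rewrite lerD2l ge_min lexx ?orbT.
  move=> e e0; have [_ [x _ <-] Jx] := inf_adherent e0 Jinf.
  by exists x.
have [e e0|p Fp] := g_complete FF.
  (* [g (x - y) (x - y)] equals [2 * (J x + J y)] minus four times [J] at the midpoint, hence is
     below [4 * (m + e / 4) - 4 * m = e]. *)
  exists [set x | J x < m + e / 4]; first by exists (e / 4) => //=; lra.
  move=> x y /= Jx Jy.
  (* parallelogram law, with midpoint [y + (x - y) / 2] *)
  have := J_expand y 1 (x - y); rewrite scale1r addrC subrK.
  have := J_expand y (1 / 2) (x - y); have := mJ (y + (1 / 2) *: (x - y)).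
  by set a := J (y + _); lra.
exists p => y.
set b := g p y - h y; set c := g y y.
have c0 : 0 <= c by exact: g_ge0.
(* For a near-minimiser [x] close to [p], [b] is the slope at [x] plus [g (p - x) y]. Both squares
   are at most [e * c], and [(u + v)^2 <= 2 * (u^2 + v^2)]. *)
have b_le e : 0 < e -> b ^+ 2 <= 4 * e * c.
  move=> e0.
  have FJ : F [set x | J x < m + e] by exists e.
  have [x [/= Jx gx]] := filter_ex (filterI FJ (Fp e e0)).
  (* Moving from [x] along [y] lowers [J] by less than [e], since [m <= J]. *)
  have x_crit : (g x y - h y) ^+ 2 <= e * c.
    apply: quadratic_lower_bound => // t.
    by have := mJ (x + t *: y); rewrite J_expand -/c; lra.
  have px_small : g (p - x) y ^+ 2 <= e * c.
    by apply: le_trans (form_CauchySchwarz _ _) _; rewrite ler_wpM2r// ltW.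
  have gpx : g (p - x) y = g p y - g x y.
    by rewrite gC addrC -scaleN1r g_scalar !(gC y); ring.
  have -> : b = (g x y - h y) + g (p - x) y by rewrite gpx /b; ring.
  by have := sqr_ge0 ((g x y - h y) - g (p - x) y); nra.
suff : b = 0 by rewrite /b; lra.
apply/eqP; apply: contraT => b0.
have b2 : 0 < b ^+ 2 by rewrite exprn_even_gt0.
have c1 : 0 < c + 1 by lra.
(* This [e] turns the bound into [b ^+ 2 <= b ^+ 2 * c / (c + 1)], which is absurd; [c + 1] allows
   for [c = 0]. *)
have /b_le : 0 < b ^+ 2 / (4 * (c + 1)) by rewrite divr_gt0// mulr_gt0.
rewrite (_ : 4 * _ * c = b ^+ 2 * c / (c + 1)); last by field; rewrite gt_eqF.
by rewrite ler_pdivlMr//; nra.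
Qed.

End RealRiesz.

(** * Restriction of scalars to the reals *)

(** An alias, since [M] itself is already a module over [bicomplex R]. *)
Definition realified (R : realType) (M : lmodType (bicomplex R)) : Type := M.

Section Realification.
Variables (R : realType) (M : lmodType (bicomplex R)).

Definition realified_scale (r : R) (x : realified M) : realified M :=
  ((r%:C)%C)%:BC *: (x : M).

Lemma bicomplex_of_realD (r s : R) :
  (((r + s)%:C)%C)%:BC = ((r%:C)%C)%:BC + ((s%:C)%C)%:BC.
Proof.
by apply: P12_inj; rewrite ?P1D ?P2D ?P1_complex ?P2_complex rmorphD.
Qed.

Lemma bicomplex_of_realM (r s : R) :
  (((r * s)%:C)%C)%:BC = ((r%:C)%C)%:BC * ((s%:C)%C)%:BC.
Proof.
by apply: P12_inj; rewrite ?P1M ?P2M ?P1_complex ?P2_complex rmorphM.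
Qed.

HB.instance Definition _ := GRing.Zmodule.copy (realified M) M.

Fact realified_scaleA a b v :
  realified_scale a (realified_scale b v) = realified_scale (a * b) v.
Proof. by rewrite /realified_scale scalerA bicomplex_of_realM. Qed.
Fact realified_scale1 : left_id 1 realified_scale.
Proof. by move=> v; rewrite /realified_scale scale1r. Qed.
Fact realified_scaleDr : right_distributive realified_scale +%R.
Proof. by move=> a u v; exact: scalerDr. Qed.
Fact realified_scaleDl v : {morph realified_scale^~ v : a b / a + b}.
Proof. by move=> a b; rewrite /realified_scale bicomplex_of_realD scalerDl. Qed.

HB.instance Definition _ := GRing.Zmodule_isLmodule.Build R (realified M)
  realified_scaleA realified_scale1 realified_scaleDr realified_scaleDl.

End Realification.

(** * A real trace on bicomplex numbers *)

(** As [P1 w + P2 w = 2 * bc1 w], this is twice the real coordinate of [w] in R^4. *)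
Definition hyperbolic_trace (R : realType) (w : bicomplex R) : R :=
  complex.Re (P1 w) + complex.Re (P2 w).

Lemma dagger3M (R : realType) : {morph @dagger3 R : w v / w * v}.
Proof.
by move=> w v; apply: P12_inj;
  rewrite ?(P1M, P1_dagger3, P2M, P2_dagger3) rmorphM.
Qed.

Section HyperbolicTrace.
Variable R : realType.
Implicit Types w v : bicomplex R.

Lemma hyperbolic_traceD w v :
  hyperbolic_trace (w + v) = hyperbolic_trace w + hyperbolic_trace v.
Proof.
rewrite /hyperbolic_trace P1D P2D.
by case: (P1 w) (P2 w) (P1 v) (P2 v) => [? ?] [? ?] [? ?] [? ?] /=; ring.
Qed.

Lemma hyperbolic_traceZ (r : R) w :
  hyperbolic_trace (((r%:C)%C)%:BC * w) = r * hyperbolic_trace w.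
Proof.
rewrite /hyperbolic_trace P1M P2M P1_complex P2_complex.
by case: (P1 w) (P2 w) => [? ?] [? ?] /=; ring.
Qed.

Lemma hyperbolic_trace_dagger3 w :
  hyperbolic_trace (dagger3 w) = hyperbolic_trace w.
Proof.
rewrite /hyperbolic_trace P1_dagger3 P2_dagger3.
by case: (P1 w) (P2 w) => [? ?] [? ?].
Qed.

(** Recovers bicomplex identities from real ones: [w = 0] once this trace vanishes. *)
Lemma hyperbolic_trace_norm w :
  hyperbolic_trace (dagger3 w * w) = 2 * bicomplex_norm w ^+ 2.
Proof.
rewrite /bicomplex_norm exprMn exprVn !sqr_sqrtr ?addr_ge0 ?sqr_ge0//.
rewrite mulVKf ?pnatr_eq0// !normc_sqr.
rewrite /hyperbolic_trace P1M P2M P1_dagger3 P2_dagger3.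
by case: (P1 w) (P2 w) => [? ?] [? ?] /=; ring.
Qed.

(** For the real parts, [(a + c)^2 <= 2 * (a^2 + c^2)], and moduli dominate real parts. *)
Lemma hyperbolic_trace_sqr_le w :
  hyperbolic_trace w ^+ 2 <= 4 * bicomplex_norm w ^+ 2.
Proof.
rewrite (_ : 4 * _ = 2 * hyperbolic_trace (dagger3 w * w)); last first.
  by rewrite hyperbolic_trace_norm; ring.
rewrite /hyperbolic_trace P1M P2M P1_dagger3 P2_dagger3.
case: (P1 w) (P2 w) => [a b] [c d] /=.
by have := sqr_ge0 (a - c); have := sqr_ge0 b; have := sqr_ge0 d; nra.
Qed.

End HyperbolicTrace.

(** * The real inner product on [M]: norm, completeness, bounded functionals *)

Section RealForm.
Variables (R : realType) (M : bicomplexPreHilbertType R).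

Definition real_form (x y : realified M) : R := hyperbolic_trace (sprod x y).

Lemma real_formC x y : real_form x y = real_form y x.
Proof.
by rewrite /real_form (sp_dagger3 sprodP) hyperbolic_trace_dagger3.
Qed.

Lemma real_form_scalar x : scalar (real_form x).
Proof.
move=> r y z; rewrite /real_form (spDr sprodP) (spZr sprodP).
by rewrite hyperbolic_traceD hyperbolic_traceZ.
Qed.

Lemma real_form_ge0 x : 0 <= real_form x x.
Proof.
have [x1 [x2 [h1 h2 e]]] := sp_hyperbolic_positive sprodP x.
by rewrite /real_form /hyperbolic_trace e P1_idempotent P2_idempotent addr_ge0.
Qed.

(** [P1 be1 = P2 be2 = 1] removes the idempotents from the induced norm; the 2 undoes its factor
    [1 / sqrt 2]. *)
Lemma real_form_norm x :
  real_form x x = 2 * induced_norm (@sprod R M) x ^+ 2.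
Proof.
have spZZ a : sprod (a *: (x : M)) (a *: (x : M)) = a * dagger3 a * sprod x x.
  rewrite (spZr sprodP) (sp_dagger3 sprodP) (spZr sprodP) dagger3M mulrA.
  by rewrite -(sp_dagger3 sprodP).
have e : induced_norm (@sprod R M) x =
    (Num.sqrt 2)^-1 * Num.sqrt (real_form x x).
  rewrite /induced_norm !spZZ (P1M (be1 * _)) (P2M (be2 * _)).
  by rewrite (P1M be1) (P2M be2) P1_dagger3 P2_dagger3 P1_be1 P2_be2
    !rmorph1 !mul1r.
rewrite e exprMn exprVn !sqr_sqrtr ?real_form_ge0//.
by rewrite mulVKf ?pnatr_eq0.
Qed.

Lemma real_form_lt x e : 0 <= e ->
  (real_form x x < 2 * e ^+ 2) = (induced_norm (@sprod R M) x < e).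
Proof.
move=> e0; rewrite real_form_norm ltr_pM2l// ltr_pXn2r// nnegrE//.
by rewrite -[induced_norm _ _](@tnormedE R M x) normr_ge0.
Qed.

End RealForm.

(** The ball of radius [r] in [tnormed M] is cut out by [real_form < 2 * r ^+ 2] on differences, so
    Cauchy filters and limits correspond. *)
Lemma real_form_complete (R : realType) (M : bicomplexHilbertType R)
    (F : set_system (realified M)) : ProperFilter F ->
  (forall e, 0 < e -> exists2 A, F A &
     forall x y, A x -> A y -> real_form (x - y) (x - y) < e) ->
  exists p, forall e, 0 < e -> F [set x | real_form (p - x) (p - x) < e].
Proof.
move=> FF Fc.
have /(tnormed_cauchy_cvg (F : set_system (tnormed M)) FF) :
    cauchy (F : set_system (tnormed M)).
  apply: cauchy_exP => e e0.
  have [|A FA sA] := Fc (2 * e ^+ 2); first by rewrite mulr_gt0// exprn_gt0.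
  have [x Ax] := filter_ex FA; exists x.
  apply: filterS FA => y Ay; have := sA _ _ Ax Ay.
  by rewrite real_form_lt ?ltW.
move=> /cvg_ex[p Fp]; exists p => e e0.
pose d := Num.sqrt (e / 2).
have d0 : 0 < d by rewrite sqrtr_gt0 divr_gt0.
have -> : e = 2 * d ^+ 2 by rewrite sqr_sqrtr ?divr_ge0 ?ltW//; field.
have := Fp _ (nbhsx_ballx (p : tnormed M) d d0).
by apply: filterS => x; rewrite /= real_form_lt ?ltW.
Qed.

Lemma continuous_scalar_bounded (R : realType) (M : bicomplexPreHilbertType R)
    (f : {scalar M}) : continuous (f : tnormed M -> bicomplex R) ->
  exists2 C, 0 <= C & forall x : realified M,
    hyperbolic_trace (f x) ^+ 2 <= C * real_form x x.
Proof.
move=> /tnormed_continuousP /(_ 0 1 ltr01) [d d0 fd].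
(* The 9 is the square of the trace 3 chosen below; 3 exceeds 2, which bounds the trace where the
   norm of [f] is below 1. *)
have C0 : 0 <= 9 / (2 * d ^+ 2) by rewrite divr_ge0// mulr_ge0// sqr_ge0.
exists (9 / (2 * d ^+ 2)) => // x.
set a := hyperbolic_trace (f x).
have [a0|a0] := eqVneq a 0.
  by rewrite a0 expr0n mulr_ge0// real_form_ge0.
(* [f] exceeds 1 at the multiple of [x] where the trace is 3, so that multiple
   lies outside the ball of radius [d] *)
pose y : realified M := (3 / a) *: x.
have fy : hyperbolic_trace (f y) = 3.
  by rewrite (linearZ_LR f) hyperbolic_traceZ -/a; field.
have gy : real_form y y = (9 / a ^+ 2) * real_form x x.
  have gZ (z : realified M) : real_form z y = (3 / a) * real_form z x.
    by rewrite /real_form (spZr sprodP) hyperbolic_traceZ.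
  by rewrite gZ real_formC gZ; field.
have : 2 * d ^+ 2 <= real_form y y.
  rewrite leNgt; apply/negP; rewrite real_form_lt ?ltW// => yd.
  have := fd (- y); rewrite add0r opprK => /(_ yd).
  rewrite linear0 linearN sub0r opprK => fy1.
  have := hyperbolic_trace_sqr_le (f y); rewrite fy.
  have : bicomplex_norm (f y) ^+ 2 < 1.
    by rewrite expr_lt1// -bicomplex_normE normr_ge0.
  by lra.
rewrite gy mulrAC ler_pdivlMr ?exprn_even_gt0// => H.
by rewrite mulrAC ler_pdivlMr ?mulr_gt0 ?exprn_gt0//; lra.
Qed.

(** * Representation of bicomplex functionals *)

Theorem theorem3p7 (R : realType) (M : bicomplexHilbertType R)
    (f : {scalar M})
    (f_continuous : continuous (f : tnormed M -> bicomplex R)) :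
  exists! psi : M, forall phi : M, f phi = sprod psi phi.
Proof.
have [C C0 fC] := continuous_scalar_bounded f_continuous.
pose h (x : realified M) := hyperbolic_trace (f x).
have hS : scalar h.
  by move=> r x y; rewrite /h linearP hyperbolic_traceD hyperbolic_traceZ.
have [psi hpsi] := real_riesz (@real_formC R M) (@real_form_scalar R M)
  (@real_form_ge0 R M) (@real_form_complete R M) hS C0 fC.
have fpsi phi : f phi = sprod (psi : M) phi.
  apply/eqP; rewrite -subr_eq0; apply/eqP; set w := _ - _.
  have := hpsi (dagger3 w *: phi).
  rewrite /h /real_form (linearZ_LR f) (spZr sprodP) => e.
  have : hyperbolic_trace (dagger3 w * w) = 0.
    rewrite /w mulrBr hyperbolic_traceD e -hyperbolic_traceD.
    by rewrite subrr /hyperbolic_trace P1_0 P2_0 addr0.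
  rewrite hyperbolic_trace_norm => /eqP.
  rewrite mulf_eq0 pnatr_eq0/= sqrf_eq0 => /eqP.
  exact: bicomplex_norm_eq0.
exists psi; split=> // psi' fpsi'.
(* Both vectors represent [f], so [x] pairs equally with [psi] and [psi'], hence to 0 with their
   difference, [x] itself. *)
apply/subr0_eq/(sp_eq0 sprodP); set x := psi - psi'.
have xpsi : sprod x psi = sprod x psi'.
  by rewrite !(sp_dagger3 sprodP x) -fpsi -fpsi'.
by rewrite {2}/x -scaleN1r (spDr sprodP) (spZr sprodP) xpsi mulN1r subrr.
Qed.
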